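(* Let $\Omega \subset \mathbb{C}^d$, $d \ge 1$, be a Kobayashi hyperbolic domain and let $W_1, W_2$ be open subsets of $\mathbb{C}^d$ with $W_1 \subset\subset W_2$, $W_1 \cap \Omega \neq \emptyset$ and $\mathsf{k}_{\Omega}(W_1 \cap \Omega, \Omega \setminus W_2) > 0$. Let $U$ and $W$ be open subsets of $\mathbb{C}^d$ with $W \subset\subset W_1 \subset\subset W_2 \subset\subset U$, $W \cap \Omega \neq \emptyset$ and $U \cap \Omega$ connected, and suppose there exists a constant $C_0 > 0$ such that for all $z, w \in W \cap \Omega$, $$\mathsf{k}_{U \cap \Omega}(z, w) \le \mathsf{k}_{\Omega}(z, w) + C_0.$$ Then there exists a constant $C \ge 1$ such that for all $z, w \in W \cap \Omega$, $$\mathsf{k}_{U \cap \Omega}(z, w) \le C\, \mathsf{k}_{\Omega}(z, w).$$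
   Context: For a domain $D \subset \mathbb{C}^d$, $\mathsf{k}_D$ is the Kobayashi pseudodistance; $D$ is Kobayashi hyperbolic if $\mathsf{k}_D$ is a distance. For $X, Y \subset D$, $\mathsf{k}_D(X,Y) = \inf_{x \in X, y \in Y} \mathsf{k}_D(x,y)$ (with $\inf\emptyset = +\infty$). $X \subset\subset U$ means that $\overline{X}$ is compact and $\overline{X} \subset U$. *)

(* Defs.v *)
From HB Require Import structures.
From mathcomp Require Import all_boot all_order all_algebra.
From mathcomp Require Import complex.
From mathcomp Require Import all_classical all_reals all_analysis.

Set Implicit Arguments.
Unset Strict Implicit.
Unset Printing Implicit Defensive.

Import Order.TTheory GRing.Theory Num.Theory.
Import numFieldNormedType.Exports.

Local Open Scope classical_set_scope.
Local Open Scope ring_scope.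

(* [R[i]] as a normed module over itself: its topology, and the sup-norm
   topology on ['rV[R[i]]_d], are the usual ones of C and C^d, and
   [derivable _ z 1] is complex differentiability at [z]. *)
HB.instance Definition _ (R : realType) :=
  NormedModule.copy (complex R) (complex R)^o.

Section Kobayashi.
Variables (R : realType) (d : nat).
Local Notation C := (complex R).
Local Notation Cd := 'rV[C]_d.

Definition unit_disc : set C := [set z | `|z| < 1].

(* artanh |(a - b) / (1 - conj(a) b)|, the distance of curvature -4; the norm
   of C takes its values in C, hence [complex.Re]. *)
Definition poincare_dist (a b : C) : R :=
  let t := complex.Re `|(a - b) / (1 - a^*%C * b)| in
  ln ((1 + t) / (1 - t)) / 2.

(* Only the values of [f] on the unit disc are relevant. *)
Definition holomorphic_disc (D : set Cd) (f : C -> Cd) : Prop :=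
  (forall z, unit_disc z -> derivable f z 1) /\
  (forall z, unit_disc z -> D (f z)).

(* Discs [f 0, ..., f n] in [D] linking [x] to [y]; the i-th one contributes
   the points [f i (a i)] and [f i (b i)]. *)
Definition disc_chain (D : set Cd) (x y : Cd) (n : nat)
    (f : nat -> C -> Cd) (a b : nat -> C) : Prop :=
  [/\ forall i, (i <= n)%N ->
        [/\ holomorphic_disc D (f i), unit_disc (a i) & unit_disc (b i)],
      f 0%N (a 0%N) = x,
      f n (b n) = y &
      forall i, (i < n)%N -> f i (b i) = f i.+1 (a i.+1)].

(* The value is [+oo] when no chain of discs in [D] links [x] to [y]; this does
   not occur for [x], [y] in a domain [D]. *)
Definition kobayashi (D : set Cd) (x y : Cd) : \bar R :=
  ereal_inf [set l | exists n f a b, disc_chain D x y n f a b /\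
    l = (\sum_(i < n.+1) poincare_dist (a i) (b i))%:E].

Definition kobayashi_set (D X Y : set Cd) : \bar R :=
  ereal_inf [set kobayashi D x y | x in X & y in Y].

Definition domain (D : set Cd) : Prop := [/\ D !=set0, open D & connected D].

Definition distance_on (D : set Cd) (k : Cd -> Cd -> \bar R) : Prop :=
  [/\ forall x y, D x -> D y -> k x y \is a fin_num /\ (0 <= k x y)%E,
      forall x y, D x -> D y -> (k x y = 0%E <-> x = y),
      forall x y, D x -> D y -> k x y = k y x &
      forall x y z, D x -> D y -> D z -> (k x z <= k x y + k y z)%E].

Definition kobayashi_hyperbolic (D : set Cd) : Prop :=
  distance_on D (kobayashi D).

Definition relatively_compact_in (X U : set Cd) : Prop :=
  compact (closure X) /\ closure X `<=` U.

End Kobayashi.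

(* Main.v *)
Require Import Defs.
From HB Require Import structures.
From mathcomp Require Import all_boot all_order all_algebra.
From mathcomp Require Import complex.
From mathcomp Require Import all_classical all_reals all_analysis.
From mathcomp Require Import ring lra.

Set Implicit Arguments.
Unset Strict Implicit.
Unset Printing Implicit Defensive.

Import Order.TTheory GRing.Theory Num.Theory.
Import numFieldNormedType.Exports.

Local Open Scope classical_set_scope.
Local Open Scope ring_scope.

(** Let delta be the Kobayashi distance in Omega from W1 to the complement of
    W2, and fix a small r with 4 r <= delta.  Two regimes are treated
    separately.

    If z and w are at distance at least r / 4 in Omega, the additive constant
    C0 is at most (4 C0 / r) k_Omega(z, w), so the additive estimate is already
    a multiplicative one.

    If they are closer, the estimate holds by a localization argument in the
    spirit of Royden ([kobayashi_localization]).  A chain of discs of length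
    less than r / 4 links z to w in Omega.  Composing each disc with a Moebius
    automorphism, which preserves the Poincare distance, makes its first marked
    point the image of the origin.  Every point of the image of the disc of
    radius r about that origin can be reached from z along the chain, truncated
    at that disc, so its distance to z is less than delta
    ([kobayashi_disc_point_le]); as z lies in W1, that point lies in W2, hence
    in U.  Restricting each disc to radius r and rescaling therefore gives a
    chain in the intersection of U and Omega.  Its second marked points t_i
    have become t_i / r, and since t_i <= r / 2 the Poincare lengths grow by a
    factor at most 4 / r ([kobayashi_le_shrunken_chain], [artanh_div_le]). *)

(** * The inverse hyperbolic tangent *)

Section Artanh.
Variable R : realType.
Implicit Types (t u r : R).

Definition artanh t : R := ln ((1 + t) / (1 - t)) / 2.

(** Apply ln (1 + x) <= x to the reciprocal (1 - t) / (1 + t), for which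
    x = - 2 t / (1 + t). *)
Lemma artanh_ge t : 0 <= t < 1 -> t / 2 <= artanh t.
Proof.
move=> /andP[t0 t1]; rewrite /artanh.
have -> : (1 + t) / (1 - t) = (1 + - (2 * t / (1 + t)))^-1.
  by field; apply/andP; split; apply/eqP; lra.
have lt1 : 2 * t / (1 + t) < 1 by rewrite ltr_pdivrMr; lra.
rewrite lnV ?posrE; last by lra.
have := @le_ln1Dx R (- (2 * t / (1 + t))).
have : t <= 2 * t / (1 + t) by rewrite ler_pdivlMr; nra.
lra.
Qed.

Lemma artanh_le u : 0 <= u < 1 -> artanh u <= u / (1 - u).
Proof.
move=> /andP[u0 u1]; rewrite /artanh.
have -> : (1 + u) / (1 - u) = 1 + 2 * (u / (1 - u)) by field; apply/eqP; lra.
have : 0 <= u / (1 - u) by rewrite divr_ge0; lra.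
have := @le_ln1Dx R (2 * (u / (1 - u))).
lra.
Qed.

(** For t <= r / 2 the quotient t / r stays away from 1, so that artanh is
    comparable with the identity both at t and at t / r. *)
Lemma artanh_div_le r t : 0 < r -> 0 <= t <= r / 2 -> t < 1 ->
  artanh (t / r) <= 4 / r * artanh t.
Proof.
move=> r0 /andP[t0 tr] t1.
have tr1 : t / r <= 1 / 2 by rewrite ler_pdivrMr; lra.
have tr0 : 0 <= t / r by rewrite divr_ge0; lra.
apply: (@le_trans _ _ (2 * (t / r))).
  apply: le_trans (artanh_le _) _; first by lra.
  by rewrite ler_pdivrMr; nra.
have -> : 2 * (t / r) = 4 / r * (t / 2) by field; apply/eqP; lra.
by apply: ler_wpM2l; [rewrite divr_ge0; lra | apply: artanh_ge; lra].
Qed.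

End Artanh.

(** * Moebius automorphisms of the unit disc *)

Section Mobius.
Local Open Scope complex_scope.
Variable R : realType.
Implicit Types (a b z : R[i]).

Lemma normC_Re z : (complex.Re `|z|)%:C = `|z|.
Proof. by rewrite normc_def. Qed.

Lemma unit_discE z : unit_disc z <-> complex.Re `|z| < 1.
Proof. by rewrite /unit_disc /= -{1}normC_Re ltcR. Qed.

Lemma Re_norm_ge0 z : 0 <= complex.Re `|z|.
Proof. by rewrite -ler0c normC_Re. Qed.

Lemma Re_normM a b :
  complex.Re `|a * b| = complex.Re `|a| * complex.Re `|b|.
Proof. by apply: complexI; rewrite rmorphM /= !normC_Re normrM. Qed.

Lemma Re_norm_real (r : R) : 0 <= r -> complex.Re `|r%:C| = r.
Proof. by move=> r0; rewrite ger0_norm// ler0c. Qed.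

Lemma unit_discN a : unit_disc a -> unit_disc (- a).
Proof. by rewrite /unit_disc /= normrN. Qed.

Lemma unit_discM_le1 (r : R) z : 0 <= r <= 1 -> unit_disc z ->
  unit_disc (r%:C * z).
Proof.
move=> /andP[r0 r1] /unit_discE z1; apply/unit_discE.
rewrite Re_normM Re_norm_real//.
by apply: le_lt_trans z1; apply: ler_piMl => //; apply: Re_norm_ge0.
Qed.

Definition mobius a z : R[i] := (z + a) / (1 + a^*%C * z).

Lemma mobius0 a : mobius a 0 = a.
Proof. by rewrite /mobius add0r mulr0 addr0 divr1. Qed.

(** |1 + conj(a) z|^2 - |z + a|^2 = (1 - |a|^2) (1 - |z|^2), which is positive
    on the disc. *)
Lemma mobius_num_lt_den a z :
  unit_disc a -> unit_disc z -> `|z + a| < `|1 + a^*%C * z|.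
Proof.
rewrite /unit_disc /= => a1 z1.
rewrite -(@ltr_pXn2r _ 2) ?nnegrE// -subr_gt0 !sqr_normc.
rewrite !rmorphD !rmorphM rmorph1 /= conjcK.
have -> : (1 + a^*%C * z) * (1 + a * z^*%C) - (z + a) * (z^*%C + a^*%C) =
   (1 - a * a^*%C) * (1 - z * z^*%C) by ring.
by rewrite -!sqr_normc; apply: mulr_gt0; rewrite subr_gt0 expr_lt1.
Qed.

Lemma mobius_den_neq0 a z : unit_disc a -> unit_disc z -> 1 + a^*%C * z != 0.
Proof.
move=> a1 z1; rewrite -normr_gt0.
exact: le_lt_trans (mobius_num_lt_den a1 z1).
Qed.

Lemma unit_disc_mobius a z :
  unit_disc a -> unit_disc z -> unit_disc (mobius a z).
Proof.
move=> a1 z1; rewrite /unit_disc /= /mobius normf_div.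
rewrite ltr_pdivrMr ?mul1r; first exact: mobius_num_lt_den.
by rewrite normr_gt0 mobius_den_neq0.
Qed.

Lemma mobiusK a z :
  unit_disc a -> unit_disc z -> mobius (- a) (mobius a z) = z.
Proof.
move=> a1 z1; have D0 := mobius_den_neq0 a1 z1.
have := mobius_den_neq0 (unit_discN a1) (unit_disc_mobius a1 z1).
have a2 : 1 - a * a^*%C != 0.
  by rewrite -sqr_normc subr_eq0 eq_sym lt_eqF// expr_lt1.
rewrite /mobius rmorphN => D1.
field.
rewrite D0 /=; apply: contraNneq a2 => h; apply/eqP; rewrite -[RHS]h; ring.
Qed.

(** The automorphism [mobius (- a)] sends [a] to the origin, where the Poincare
    distance depends on the modulus only. *)
Lemma poincare_dist_mobius a b :
  poincare_dist a b = artanh (complex.Re `|mobius (- a) b|).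
Proof.
by rewrite /poincare_dist /artanh /mobius rmorphN mulNr !normf_div distrC.
Qed.

Lemma derivable_mobius a (r : R) z : unit_disc a -> unit_disc (r%:C * z) ->
  derivable (fun z => mobius a (r%:C * z)) z 1.
Proof.
move=> a1 z1.
have D0 := mobius_den_neq0 a1 z1.
have dlin : derivable (fun z : R[i] => r%:C * z) z 1.
  by apply: derivableM; [exact: derivable_cst | exact: derivable_id].
rewrite /mobius; apply: derivableM.
  by apply: derivableD; [exact: dlin | exact: derivable_cst].
have dden : derivable (fun z : R[i] => 1 + a^*%C * (r%:C * z)) z 1.
  apply: derivableD; first exact: derivable_cst.
  by apply: derivableM; [exact: derivable_cst | exact: dlin].
pose den (z : R[i]) := 1 + a^*%C * (r%:C * z).
exact: (@derivableV R[i] _ den z 1 D0 dden).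
Qed.

End Mobius.

(** * Shrinking chains of discs *)

Section Chains.
Local Open Scope complex_scope.
Variables (R : realType) (d : nat).
Local Notation C := (complex R).
Local Notation Cd := 'rV[C]_d.
Implicit Types (D : set Cd) (f : nat -> C -> Cd) (a b : nat -> C) (g : C -> Cd).

Lemma poincare_dist_ge0 (u v : C) :
  unit_disc u -> unit_disc v -> 0 <= poincare_dist u v.
Proof.
move=> u1 v1; rewrite poincare_dist_mobius.
have := Re_norm_ge0 (mobius (- u) v).
have /unit_discE := unit_disc_mobius (unit_discN u1) v1.
set t := complex.Re _ => t1 t0.
by apply: le_trans (artanh_ge _); rewrite ?divr_ge0 ?t0.
Qed.

Lemma norm_mobius_le_poincare_dist (u v : C) : unit_disc u -> unit_disc v ->
  complex.Re `|mobius (- u) v| <= 2 * poincare_dist u v.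
Proof.
move=> u1 v1; rewrite poincare_dist_mobius.
have := Re_norm_ge0 (mobius (- u) v).
have /unit_discE := unit_disc_mobius (unit_discN u1) v1.
set t := complex.Re _ => t1 t0.
have := @artanh_ge R t; rewrite t0 t1 => /(_ isT); lra.
Qed.

Lemma kobayashi_le_chain D x y n f a b : disc_chain D x y n f a b ->
  (kobayashi D x y <= (\sum_(i < n.+1) poincare_dist (a i) (b i))%:E)%E.
Proof. by move=> ch; apply: ereal_inf_lbound; exists n, f, a, b. Qed.

Lemma holomorphic_disc_recentre D D' g (c : C) (r : R) :
  holomorphic_disc D g -> unit_disc c -> 0 <= r <= 1 ->
  (forall z, unit_disc z -> D' (g (mobius c (r%:C * z)))) ->
  holomorphic_disc D' (fun z => g (mobius c (r%:C * z))).
Proof.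
move=> [dg _] c1 r01 gD'; split; last exact: gD'.
move=> z z1.
have rz1 := unit_discM_le1 r01 z1.
apply/derivable1_diffP.
apply: (@differentiable_comp _ _ _ _ (fun z : C => mobius c (r%:C * z)) g).
  by apply/derivable1_diffP; exact: derivable_mobius.
by apply/derivable1_diffP; apply: dg; exact: unit_disc_mobius.
Qed.

(** Stop the chain at its [i]-th disc and move the last marked point there: the
    point [mobius (a i) z] is at Poincare distance artanh |z| from [a i]. *)
Lemma kobayashi_disc_point_le D x y n f a b i (z : C) :
  disc_chain D x y n f a b -> (i <= n)%N -> unit_disc z ->
  (kobayashi D x (f i (mobius (a i) z)) <=
   (\sum_(j < n.+1) poincare_dist (a j) (b j) + artanh (complex.Re `|z|))%:E)%E.
Proof.
move=> [fab f0 _ flink] le_in z1.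
have [fi ai bi] := fab i le_in.
pose b' j := if j == i then mobius (a i) z else b j.
have ch : disc_chain D x (f i (mobius (a i) z)) i f a b'.
  split=> //.
  - move=> j le_ji; have [fj aj bj] := fab j (leq_trans le_ji le_in).
    by split=> //; rewrite /b'; case: eqP => // _; exact: unit_disc_mobius.
  - by rewrite /b' eqxx.
  - move=> j lt_ji; rewrite /b' ltn_eqF//.
    by apply: flink; exact: leq_trans le_in.
apply: le_trans (kobayashi_le_chain ch) _; rewrite lee_fin.
rewrite big_ord_recr /= {2}/b' eqxx poincare_dist_mobius mobiusK//.
rewrite lerD2r -(big_mkord xpredT (fun j => poincare_dist (a j) (b' j))).
rewrite -(big_mkord xpredT (fun j => poincare_dist (a j) (b j))).
rewrite (@big_cat_nat _ _ _ i 0%N n.+1)//=; last exact: leqW.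
rewrite ler_wpDr//.
  rewrite big_nat; apply: sumr_ge0 => j /andP[_ le_jn].
  by have [_ aj bj] := fab j le_jn; exact: poincare_dist_ge0.
by apply: ler_sum_nat => j /andP[_ lt_ji]; rewrite /b' ltn_eqF.
Qed.

(** The new discs are the old ones, recentred at [a i] and restricted to radius
    [r]; they only have to stay in [D'] on that smaller disc.  The bound on the
    individual lengths keeps the rescaled second marked points in the disc of
    radius 1 / 2. *)
Lemma kobayashi_le_shrunken_chain D D' x y n f a b (r : R) :
  0 < r <= 1 -> disc_chain D x y n f a b ->
  (forall i z, (i <= n)%N -> unit_disc z ->
     D' (f i (mobius (a i) (r%:C * z)))) ->
  (forall i, (i <= n)%N -> poincare_dist (a i) (b i) <= r / 4) ->
  (kobayashi D' x y <=
   (4 / r * \sum_(i < n.+1) poincare_dist (a i) (b i))%:E)%E.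
Proof.
move=> /andP[r0 r1] [fab f0 fn flink] fD' short.
have rC0 : r%:C != 0 by rewrite gt_eqF// ltcR.
pose g i z := f i (mobius (a i) (r%:C * z)).
pose c i := mobius (- a i) (b i) / r%:C.
have rc i : (i <= n)%N -> g i (c i) = f i (b i).
  move=> le_in; have [_ ai bi] := fab i le_in.
  rewrite /g /c mulrC divfK// -{1}[a i]opprK mobiusK//.
  exact: unit_discN.
have norm_c i : complex.Re `|c i| = complex.Re `|mobius (- a i) (b i)| / r.
  by rewrite /c -fmorphV Re_normM Re_norm_real// invr_ge0 ltW.
have small i : (i <= n)%N -> complex.Re `|mobius (- a i) (b i)| <= r / 2.
  move=> le_in; have [_ ai bi] := fab i le_in.
  by have := norm_mobius_le_poincare_dist ai bi; have := short i le_in; lra.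
have ch : disc_chain D' x y n g (fun=> 0) c.
  split.
  - move=> i le_in; have [fi ai bi] := fab i le_in; split.
    + apply: holomorphic_disc_recentre fi ai _ _; first by lra.
      by move=> z; exact: fD'.
    + by rewrite /unit_disc /= normr0.
    + apply/unit_discE; rewrite norm_c ltr_pdivrMr//.
      by have := small i le_in; lra.
  - by rewrite /g mulr0 mobius0.
  - by rewrite rc.
  - move=> i lt_in; rewrite rc 1?ltnW// flink//.
    by rewrite /g mulr0 mobius0.
apply: le_trans (kobayashi_le_chain ch) _; rewrite lee_fin mulr_sumr.
apply: ler_sum => -[i /= le_in] _; have [_ ai bi] := fab i le_in.
rewrite !poincare_dist_mobius oppr0 {1}/mobius conjc0 mul0r !addr0 divr1 norm_c.
apply: artanh_div_le => //; first by rewrite Re_norm_ge0 small.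
by apply/unit_discE/unit_disc_mobius => //; exact: unit_discN.
Qed.

(** A multiplicative comparison near [x] as soon as [D'] contains a Kobayashi
    ball of [D] about [x]; the factor depends on the radius of that ball only.  The
    radius [4 * r] leaves room for a chain of length [r / 4] followed by
    artanh r <= r / (1 - r) <= 2 r. *)
Lemma kobayashi_localization D D' x (r : R) : 0 < r <= 1 / 2 ->
  (forall y, D y -> (kobayashi D x y < (4 * r)%:E)%E -> D' y) ->
  forall y, (kobayashi D x y < (r / 4)%:E)%E ->
    (kobayashi D' x y <= (4 / r)%:E * kobayashi D x y)%E.
Proof.
move=> /andP[r0 r2] DD' y kxy.
have r4 : 0 < 4 / r by rewrite divr_gt0.
have short n f a b : disc_chain D x y n f a b ->
    \sum_(i < n.+1) poincare_dist (a i) (b i) < r / 4 ->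
    (kobayashi D' x y <=
     (4 / r * \sum_(i < n.+1) poincare_dist (a i) (b i))%:E)%E.
  move=> ch len; have [fab _ _ _] := ch.
  apply: (kobayashi_le_shrunken_chain _ ch); first by lra.
  - move=> i z le_in z1; have [[_ fiD] ai bi] := fab i le_in.
    have rz : unit_disc (r%:C * z) by apply: unit_discM_le1 => //; lra.
    apply: DD'; first by apply: fiD; exact: unit_disc_mobius.
    apply: le_lt_trans (kobayashi_disc_point_le ch le_in rz) _.
    have z0 := Re_norm_ge0 z; have /unit_discE z1' := z1.
    rewrite lte_fin Re_normM Re_norm_real; last by lra.
    set t := r * _; have tr : t <= r by rewrite /t; nra.
    have t0 : 0 <= t by rewrite /t mulr_ge0// ltW.
    have := @artanh_le R t; rewrite t0 /= => /(_ _).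
    have : t / (1 - t) <= 2 * r by rewrite ler_pdivrMr; nra.
    have -> : t < 1 by lra.
    by move=> ? /(_ isT); lra.
  - move=> i le_in; apply: le_trans (ltW len).
    rewrite (bigD1 (Ordinal (le_in : i < n.+1)%N))//= ler_wpDr//.
    apply: sumr_ge0 => -[j /= le_jn] _; have [_ aj bj] := fab j le_jn.
    exact: poincare_dist_ge0.
rewrite -lee_pdivrMl//; apply: le_ereal_inf_tmp => _ [n [f [a [b [ch ->]]]]].
rewrite lee_pdivrMl// -EFinM.
have [len|len] := ltP (\sum_(i < n.+1) poincare_dist (a i) (b i)) (r / 4).
  exact: short ch len.
(* A chain that is not short is longer than some short one. *)
have [_ [m [f' [a' [b' [ch' ->]]]]]] := ereal_inf_lt kxy.
rewrite lte_fin => len'; apply: le_trans (short _ _ _ _ ch' len') _.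
by rewrite lee_fin ler_wpM2l ?ltW//; apply: lt_le_trans len.
Qed.

End Chains.

(** * From an additive to a multiplicative comparison *)

Theorem theorem1p8 (R : realType) (d : nat) (d_ge1 : (1 <= d)%N)
    (Omega W1 W2 U W : set 'rV[complex R]_d)
    (Omega_domain : domain Omega)
    (Omega_hyp : kobayashi_hyperbolic Omega)
    (W1_open : open W1) (W2_open : open W2)
    (W1_W2 : relatively_compact_in W1 W2)
    (W1_meets : W1 `&` Omega !=set0)
    (k_gt0 : (0 < kobayashi_set Omega (W1 `&` Omega) (Omega `\` W2))%E)
    (U_open : open U) (W_open : open W)
    (W_W1 : relatively_compact_in W W1)
    (W2_U : relatively_compact_in W2 U)
    (W_meets : W `&` Omega !=set0)
    (U_conn : connected (U `&` Omega))
    (additive_loc : exists2 C0 : R, 0 < C0 &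
      forall z w, (W `&` Omega) z -> (W `&` Omega) w ->
        (kobayashi (U `&` Omega) z w <= kobayashi Omega z w + C0%:E)%E) :
  exists2 C : R, 1 <= C &
    forall z w, (W `&` Omega) z -> (W `&` Omega) w ->
      (kobayashi (U `&` Omega) z w <= C%:E * kobayashi Omega z w)%E.
Proof.
have [C0 C0_gt0 add_loc] := additive_loc.
have [k_fin _ _ _] := Omega_hyp.
(* The cap at 1 / 2 also covers an infinite separation, which occurs when Omega
   is contained in W2. *)
have [r /andP[r0 r2] rk] : exists2 r : R, 0 < r <= 1 / 2 &
    ((4 * r)%:E <= kobayashi_set Omega (W1 `&` Omega) (Omega `\` W2))%E.
  move: k_gt0; case: (kobayashi_set _ _ _) => [k| |] //.
    rewrite lte_fin => k0; exists (Num.min (1 / 2) (k / 4)).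
      by rewrite lt_min ge_min lexx/= !divr_gt0.
    have : Num.min (1 / 2) (k / 4) <= k / 4 by rewrite ge_min lexx orbT.
    by rewrite lee_fin; lra.
  by exists (1 / 2); [rewrite lexx divr_gt0 | rewrite leey].
have r4 : 0 < 4 / r by rewrite divr_gt0.
exists (1 + 4 / r + C0 * (4 / r)).
  by have : 0 < C0 * (4 / r) by [exact: mulr_gt0]; lra.
move=> z w Wz Ww; have [zW zO] := Wz; have [wW wO] := Ww.
have [] := k_fin z w zO wO.
(* A point of Omega at distance less than 4 r from z cannot lie outside W2. *)
have local : (kobayashi Omega z w < (r / 4)%:E)%E ->
    (kobayashi (U `&` Omega) z w <= (4 / r)%:E * kobayashi Omega z w)%E.
  apply: kobayashi_localization; first by rewrite r0.
  move=> y yO near_y; split=> //; apply: W2_U.2; apply: subset_closure.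
  apply: contrapT => yW2; move: near_y; apply/negP; rewrite -leNgt.
  apply: le_trans rk _; apply: ereal_inf_lbound.
  exists z; last by exists y.
  by split=> //; apply: W_W1.2; exact: subset_closure.
move: (add_loc z w Wz Ww) local.
case: (kobayashi Omega z w) => [k| |]// add loc _; rewrite lee_fin => k0.
have Cr0 : 0 < C0 * (4 / r) by rewrite mulr_gt0.
have [kr|kr] := ltP k (r / 4).
  apply: le_trans (loc _) _; first by rewrite lte_fin.
  by rewrite -!EFinM lee_fin; nra.
apply: le_trans add _; rewrite -EFinM -EFinD lee_fin.
have : C0 <= C0 * (4 / r) * k.
  by rewrite -[leLHS]mulr1 -mulrA ler_pM2l// -ler_pdivrMl// invf_div mulr1.
by nra.
Qed.
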